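(* Let $\ell\ge1$ and let $(\tilde L^n)_{n\ge n_0}$ be a sequence of weighted graphs, each with vertex set $[\ell]=\{1,\dots,\ell\}$. Let $(\mathbf{u}^{(n)})_{n\ge n_0}$ be a sequence of lists of real numbers, each indexed by subsets of $[\ell]$, i.e. $\mathbf{u}^{(n)}=(u^{(n)}_\Delta)_{\Delta\subseteq[\ell]}$. Assume that, for each $n\ge n_0$ and each $\Delta\subseteq[\ell]$, we have $u^{(n)}_\Delta\ne0$. If $(\mathbf{u}^{(n)})_{n\ge n_0}$ has the $\tilde L^n$ quasi-factorization property, then it also has the $\tilde L^n$ small cumulant property. Assume moreover that the maximal weight of $\tilde L^n$ tends to $0$ as $n\to\infty$. Then the converse also holds: $(\mathbf{u}^{(n)})_{n\ge n_0}$ has the $\tilde L^n$ small cumulant property if and only if it has the $\tilde L^n$ quasi-factorization property.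
   Context: A weighted graph is a finite simple graph with a weight in $[0,1]$ on each edge. For a subset $\Delta$ of vertices, $\tilde L[\Delta]$ is the induced weighted subgraph. For a weighted graph $K$, $\mathcal{M}(K)$ is the maximum over spanning trees of $K$ of the product of the edge weights of the tree ($0$ by convention if $K$ is disconnected). For a list $\mathbf{u}=(u_\Delta)_{\Delta\subseteq[\ell]}$ of nonzero real numbers define, for $\Delta\subseteq[\ell]$ nonempty, $$\kappa_\Delta(\mathbf{u})=\sum_{\pi}(-1)^{\#(\pi)-1}(\#(\pi)-1)!\prod_{B\in\pi}\frac{u_B}{u_\emptyset},\qquad P_\Delta(\mathbf{u})=\prod_{\delta\subseteq\Delta}(u_\delta)^{(-1)^{|\Delta|-|\delta|}},$$ where the sum is over all set partitions $\pi$ of $\Delta$ and $\#(\pi)$ is the number of blocks of $\pi$. The sequence $(\mathbf{u}^{(n)})$ has the $\tilde L^n$ small cumulant property if, for any $\Delta\subseteq[\ell]$ of size at least $2$, $$|\kappa_\Delta(\mathbf{u}^{(n)})|=\left(\prod_{i\in\Delta}\frac{u^{(n)}_{\{i\}}}{u^{(n)}_\emptyset}\right)\cdot O\big(\mathcal{M}(\tilde L^n[\Delta])\big)\quad\text{as }n\to\infty.$$ It has the $\tilde L^n$ quasi-factorization property if, for any $\Delta\subseteq[\ell]$ of size at least $2$, $$P_\Delta(\mathbf{u}^{(n)})=1+O\big(\mathcal{M}(\tilde L^n[\Delta])\big)\quad\text{as }n\to\infty.$$ *)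

(* Defs.v *)
From mathcomp Require Export all_boot all_order all_algebra.
From mathcomp Require Export all_classical all_reals all_analysis.
Export Order.TTheory GRing.Theory Num.Theory.
Export numFieldNormedType.Exports.

Set Implicit Arguments.
Unset Strict Implicit.
Unset Printing Implicit Defensive.

Local Open Scope classical_set_scope.
Local Open Scope ring_scope.

(* Edges are 2-element sets of vertices. The vertex set is a field so that
   induced subgraphs live over the same ambient type [V]. *)
Record wgraph (R : realType) (V : finType) := WGraph {
  vertices : {set V};
  edges : {set {set V}};
  weight : {set V} -> R;
  edge_size : forall e, e \in edges -> #|e| = 2;
  edge_sub : forall e, e \in edges -> e \subset vertices;
  weight_itv : forall e, e \in edges -> 0 <= weight e <= 1
}.

Section WeightedGraphs.
Context {R : realType} {V : finType}.
Implicit Types (K : wgraph R V) (D S : {set V}) (T : {set {set V}}).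

Definition induced_edges K D : {set {set V}} :=
  [set e in edges K | e \subset D]%SET.

Lemma induced_edge_size K D e : e \in induced_edges K D -> #|e| = 2.
Proof. by rewrite inE => /andP[/edge_size]. Qed.

Lemma induced_edge_sub K D e :
  e \in induced_edges K D -> e \subset (vertices K :&: D)%SET.
Proof. by rewrite inE finset.subsetI => /andP[/edge_sub -> ->]. Qed.

Lemma induced_weight_itv K D e :
  e \in induced_edges K D -> 0 <= weight K e <= 1.
Proof. by rewrite inE => /andP[/weight_itv]. Qed.

Definition induced K D : wgraph R V :=
  WGraph (@induced_edge_size K D) (@induced_edge_sub K D)
         (@induced_weight_itv K D).

Definition adj T : rel V := fun x y => ([set x; y] \in T)%SET.

Definition connected_on S T : Prop :=
  forall x y, x \in S -> y \in S -> connect (adj T) x y.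

(* A closed walk x, y, x of length 2 is not a cycle. *)
Definition acyclic T : Prop :=
  forall c : seq V, (3 <= size c)%N -> ~ ucycle (adj T) c.

Definition spanning_tree K T : Prop :=
  [/\ T \subset edges K, connected_on (vertices K) T & acyclic T].

(* The default value 0 is the convention for disconnected graphs. It does not
   affect the maximum otherwise, as all the products are nonnegative. *)
Definition max_tree_weight K : R :=
  \big[Num.max/0]_(T : {set {set V}} | `[< spanning_tree K T >])
    \prod_(e in T) weight K e.

Definition max_weight K : R := \big[Num.max/0]_(e in edges K) weight K e.

End WeightedGraphs.

Section Lists.
Context {R : realType} {l : nat}.
Implicit Types (u : {set 'I_l} -> R) (D : {set 'I_l}).

Definition cumulant u D : R :=
  \sum_(pi : {set {set 'I_l}} | finset.partition pi D)
    (-1) ^+ (#|pi| - 1) * ((#|pi| - 1)`!)%:R *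
    \prod_(B in pi) (u B / u finset.set0).

Definition alt_prod u D : R :=
  \prod_(d : {set 'I_l} | d \subset D)
    u d ^ ((-1) ^+ (#|D| - #|d|) : int).

Implicit Types (L : nat -> wgraph R 'I_l) (v : nat -> {set 'I_l} -> R).

Definition small_cumulant_property L v : Prop :=
  forall D : {set 'I_l}, (2 <= #|D|)%N ->
    exists2 h : nat -> R,
      h =O_\oo (fun n => max_tree_weight (induced (L n) D)) &
      \forall n \near \oo, `|cumulant (v n) D| =
        (\prod_(i in D) (v n [set i]%SET / v n finset.set0)) * h n.

Definition quasi_factorization_property L v : Prop :=
  forall D : {set 'I_l}, (2 <= #|D|)%N ->
    (fun n => alt_prod (v n) D) =
      (fun=> 1) +O_\oo (fun n => max_tree_weight (induced (L n) D)).

End Lists.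

(* Main.v *)
Require Import Defs.
From mathcomp Require Import lra.
Local Open Scope classical_set_scope.
Local Open Scope ring_scope.

(** Divide out the singletons. Since [D |-> P_D] is the multiplicative Moebius
    transform of [u], one has
    u_C / u_0 = (prod_(i in C) u_i / u_0) * prod_(d in C, |d| >= 2) (1 + r_d)
    with [r_d = P_d - 1], and the first factor just scales every cumulant.  So
    both properties concern the cumulants of the factored list
    [factored r C = prod_(d in C, |d| >= 2) (1 + r_d)]: one says that [r_D] is
    [O(M_D)], the other that [kappa_D (factored r)] is, where [M_D] is the
    maximal tree weight on [D].

    Expanding the products, [kappa_D (factored r)] becomes a sum over
    hypergraphs [H] on [D] of [prod_(d in H) r_d] times a purely combinatorial
    coefficient ([cumulant_factored]).  That coefficient is the cumulant of a
    list which splits as a product along every cut of [D] that [H] does not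
    cross, so it vanishes unless [H] is connected; this is the classical
    vanishing of mixed cumulants of independent variables
    ([cumulant_factorized], from the recursion [moment_cumulant]).  For
    connected [H], the union of optimal trees of the hyperedges connects [D],
    and as the weights are at most [1] this gives
    [prod_(d in H) M_d <= M_D] ([prod_max_tree_weight_le]).  Hence
    [r = O(M)] implies [kappa = O(M)].

    For the converse, induct on [|D|].  Replacing [r_D] by [0] gives a list
    [factored r'] whose cumulant is [O(M_D)] by the first part and the
    induction hypothesis, whereas
    [kappa_D (factored r) - kappa_D (factored r') = r_D * factored r' D]
    ([factored_cumulant_sub]).  When the weights tend to [0], so does [r_d] for
    the proper subsets [d], hence [factored r' D] stays away from [0] and
    one can divide.

    Connectedness of graphs and of hypergraphs is expressed by cuts
    ([linked]), which makes unions of trees along a hypergraph immediate. *)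

(** * Connectedness by cuts *)

Section Linked.
Import mathcomp.boot.finset.
Local Open Scope set_scope.
Set Implicit Arguments. Unset Strict Implicit.
Context {V : finType}.
Implicit Types (A D e : {set V}) (H T : {set {set V}}).

Definition splits A e := (e :&: A != set0) && (e :\: A != set0).

(** Connectedness on the ground set [D] of the hypergraph with hyperedges [H];
    a graph is the case where all members of [H] are pairs. *)
Definition linked H D :=
  [forall A, splits A D ==> [exists e in H, splits A e]].

Lemma splitsP A e :
  reflect (exists x y, [/\ x \in e, y \in e, x \in A & y \notin A])
          (splits A e).
Proof.
apply: (iffP andP) => [[/set0Pn[x] /setIP[xe xA] /set0Pn[y] /setDP[ye yA]]|].
  by exists x, y.
case=> x [y [xe ye xA yA]]; split; apply/set0Pn.
  by exists x; rewrite inE xe.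
by exists y; rewrite inE yA.
Qed.

Lemma linkedP H D :
  reflect (forall A, splits A D -> exists2 e, e \in H & splits A e)
          (linked H D).
Proof.
apply: (iffP forallP) => [h A sA|h A].
  by have /existsP[e /andP[]] := implyP (h A) sA; exists e.
by apply/implyP => /h[e eH sA]; apply/existsP; exists e; rewrite eH.
Qed.

(** A cut crossed by no edge is a union of connected components. *)
Lemma closed_adj T A : (forall e, e \in T -> ~~ splits A e) ->
  fingraph.closed (adj T) (mem A).
Proof.
move=> ns x y; rewrite /adj => xyT; have /negP nxy := ns _ xyT.
apply/idP/idP => h; apply/negPn/negP => h'; apply: nxy; apply/splitsP.
  by exists x, y; rewrite !inE !eqxx orbT.
by exists y, x; rewrite !inE !eqxx orbT.
Qed.

Lemma connected_linked T D : connected_on D T -> linked T D.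
Proof.
move=> cT; apply/linkedP => A /splitsP[x [y [xD yD xA yA]]].
case: (boolP [exists e in T, splits A e]) => [/existsP[e /andP[]]|]; first by exists e.
rewrite negb_exists => /forallP ns; exfalso.
have cl : fingraph.closed (adj T) (mem A).
  by apply: closed_adj => e eT; have := ns e; rewrite eT.
by have := closed_connect cl (cT x y xD yD); rewrite /= xA (negPf yA).
Qed.

Lemma linked_connected T D : (forall e, e \in T -> #|e| = 2) ->
  linked T D -> connected_on D T.
Proof.
move=> size2 /linkedP lT x y xD yD; apply/negPn/negP => nxy.
(* The component of x would be a cut of D; an edge crossing it leaves it. *)
have [] := lT [set z | connect (adj T) x z].
  by apply/splitsP; exists x, y; rewrite !inE connect0.
move=> e eT /splitsP[a [b [ae be]]]; rewrite !inE => xa /negP nb; apply: nb.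
apply: connect_trans xa _; have [->//|nab] := eqVneq a b.
apply: connect1; rewrite /adj; suff -> : [set a; b] = e by [].
apply/eqP; rewrite eqEcard size2 // cards2 nab andbT.
by apply/fintype.subsetP => z /set2P[]->.
Qed.

(** What remains of a cycle [x, y, z, q] once its edge [x, y] is removed: every
    edge of the arc from [z] back to [x] has an end outside [x, y]. *)
Lemma arc_avoids T (x y z : V) q :
  z \notin [set x; y] -> all [predC [set x; y]] q ->
  path (adj T) z (rcons q x) -> path (adj (T :\ [set x; y])) z (rcons q x).
Proof.
elim: q z => [|t q IH] z zn /=.
  move=> _ /andP[zx _]; rewrite andbT /adj !inE; apply/andP; split=> //.
  by apply: contraNneq zn => <-; rewrite !inE eqxx.
move=> /andP[tn qn] /andP[zt p]; rewrite IH // andbT /adj in_setD1.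
rewrite -/(adj T z t) zt andbT.
by apply: contraNneq zn => <-; rewrite !inE eqxx.
Qed.

(** An edge of a cycle may be removed without disconnecting the graph, since the
    rest of the cycle still joins its two ends. *)
Lemma minimal_linked_acyclic T D : minset (linked^~ D) T -> acyclic T.
Proof.
case/minsetP=> /linkedP lT minT [|x [|y [|z q]]] // _ /andP[].
rewrite /= !inE !negb_or -!andbA => /and3P[xyT yzT p].
case/and5P=> xy xz xq yz /and3P[yq zq _].
set T' := T :\ [set x; y].
have pT' : path (adj T') y (rcons (z :: q) x).
  rewrite /= arc_avoids ?inE ?negb_or ?[z == _]eq_sym ?xz ?yz //; last first.
    by apply/allP => t tq; rewrite !inE negb_or; apply/andP; split;
       apply: contraTneq tq => ->.
  rewrite andbT /adj in_setD1 -/(adj T y z) yzT andbT.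
  by apply/eqP => /setP/(_ z); rewrite !inE eqxx orbT ![z == _]eq_sym (negPf xz) (negPf yz).
have cyx : connect (adj T') y x.
  by apply/connectP; exists (rcons (z :: q) x); rewrite ?last_rcons.
(* By minimality it suffices that T' still crosses every cut: a cut that only
   [x, y] crosses would separate x from y, which T' connects. *)
have : T' = T.
  apply: minT; last exact: subsetDl.
  apply/linkedP => A sA; apply: contrapT => nA.
  have ns e : e \in T' -> ~~ splits A e.
    by move=> eT'; apply/negP => sAe; apply: nA; exists e.
  have [e eT se] := lT A sA; move: (ns e); rewrite /T' in_setD1 eT andbT se.
  case: (eqVneq e [set x; y]) => [ee _|_ /(_ isT)//].
  have := closed_connect (closed_adj ns) cyx; rewrite /= => yAx.
  by move: se; rewrite ee => /splitsP[a [b [/set2P[]-> /set2P[]->]]];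
     rewrite ?yAx => ->.
by move/setP/(_ [set x; y]); rewrite in_setD1 eqxx -/(adj T x y) xyT.
Qed.
End Linked.

(** * Maximal weights of spanning trees *)

Section TreeWeights.
Import mathcomp.boot.finset.
Local Open Scope set_scope.
Set Implicit Arguments. Unset Strict Implicit.
Context {R : realType} {V : finType}.
Implicit Types (K : wgraph R V) (A D : {set V}) (H T : {set {set V}}).

Lemma ler_prod_superset T T' (f : {set V} -> R) :
  (forall e, e \in T' -> 0 <= f e <= 1) -> T \subset T' ->
  \prod_(e in T') f e <= \prod_(e in T) f e.
Proof.
move=> f01 sTT'; rewrite (big_setID T) /= (setIidPr sTT').
have f01T e : e \in T -> 0 <= f e <= 1 by move=> /(fintype.subsetP sTT') /f01.
rewrite ler_piMr //; first by apply: prodr_ge0 => e /f01T/andP[].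
by apply: prodr_ile1 => e /setDP[eT _]; apply: f01.
Qed.

Lemma max_tree_weight_ge0 K : 0 <= max_tree_weight K.
Proof. exact: bigmax_ge_id. Qed.

(** Any connected spanning subgraph will do in place of a tree: it contains a
    spanning tree, and discarding edges does not decrease the product. *)
Lemma prod_weight_le_max_tree K T : T \subset edges K ->
  linked T (vertices K) -> \prod_(e in T) weight K e <= max_tree_weight K.
Proof.
move=> sTE lT; have [T' mT' sT'] := minset_exists (P := linked^~ (vertices K)) lT.
have sE := fintype.subset_trans sT' sTE.
apply: (@le_trans _ _ (\prod_(e in T') weight K e)).
  apply: ler_prod_superset => // e eT.
  exact/weight_itv/(fintype.subsetP sTE).
apply: (le_bigmax_cond 0 (fun T => \prod_(e in T) weight K e)).
apply/asboolP; split=> //; last exact: minimal_linked_acyclic mT'.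
apply: linked_connected; last by case/minsetP: mT'.
by move=> e /(fintype.subsetP sE)/edge_size.
Qed.

(** A zero value covers the disconnected case, where there is no tree. *)
Lemma max_tree_attained K : max_tree_weight K != 0 ->
  exists T, [/\ T \subset edges K, linked T (vertices K)
    & max_tree_weight K = \prod_(e in T) weight K e].
Proof.
rewrite /max_tree_weight.
elim/big_ind: _ => [|x y hx hy|T /asboolP[sT cT _] _]; first by rewrite eqxx.
  by case: (leP x y).
by exists T; split=> //; apply: connected_linked.
Qed.

Lemma vertices_induced K D : vertices K = [set: V] -> vertices (induced K D) = D.
Proof. by move=> /= ->; rewrite setTI. Qed.

Lemma linked_bigcup H D (T : {set V} -> {set {set V}}) :
  linked H D -> (forall e, e \in H -> linked (T e) e) ->
  linked (\bigcup_(e in H) T e) D.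
Proof.
move=> /linkedP lH lT; apply/linkedP => A /lH[d dH sd].
have [e eT se] := linkedP _ _ (lT d dH) A sd.
by exists e => //; apply/bigcupP; exists d.
Qed.

(** On the left an element is counted once for each [T d] that contains it,
    which only decreases the product as the factors are at most [1]. *)
Lemma ler_prod_bigcup H (T : {set V} -> {set {set V}}) (f : {set V} -> R) :
  (forall e, e \in \bigcup_(d in H) T d -> 0 <= f e <= 1) ->
  \prod_(d in H) \prod_(e in T d) f e <=
  \prod_(e in \bigcup_(d in H) T d) f e.
Proof.
move=> f01; rewrite (exchange_big_dep (mem (\bigcup_(d in H) T d))) /=; last first.
  by move=> d e dH eT; apply/bigcupP; exists d.
apply: ler_prod => e eU; have /andP[f0 f1] := f01 e eU.
rewrite prodr_const exprn_ge0 //= ler_iXnr //.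
by case/bigcupP: eU => d dH eT; apply/card_gt0P; exists d; rewrite unfold_in /= dH.
Qed.

(** Glue optimal trees of the hyperedges: their union connects [D] because [H]
    does. *)
Lemma prod_max_tree_weight_le K H D : vertices K = [set: V] ->
  (forall d, d \in H -> d \subset D) -> linked H D ->
  \prod_(d in H) max_tree_weight (induced K d) <= max_tree_weight (induced K D).
Proof.
move=> vK sHD lH; have vI d := @vertices_induced K d vK.
have [/existsP[d /andP[dH /eqP M0]]|] :=
  boolP [exists d in H, max_tree_weight (induced K d) == 0].
  by rewrite (big_setD1 d) //= M0 mul0r max_tree_weight_ge0.
rewrite negb_exists => /forallP n0.
have /boolp.choice[T hT] : forall d, exists T, d \in H ->
    [/\ T \subset edges (induced K d), linked T d
    & max_tree_weight (induced K d) = \prod_(e in T) weight K e].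
  move=> d; have := n0 d; rewrite negb_and; case: (d \in H) => /=; last by exists set0.
  by move/max_tree_attained => [T]; rewrite vI => hT; exists T.
have sU : \bigcup_(d in H) T d \subset edges (induced K D).
  apply/bigcupsP => d dH; have [sT _ _] := hT d dH.
  apply: (fintype.subset_trans sT); apply/fintype.subsetP => e; rewrite /= !inE.
  by move=> /andP[-> /= ed]; apply: (fintype.subset_trans ed (sHD d dH)).
rewrite (eq_bigr (fun d => \prod_(e in T d) weight K e)); last first.
  by move=> d /hT[].
apply: le_trans (ler_prod_bigcup _) _.
  by move=> e /(fintype.subsetP sU)/weight_itv.
apply: (prod_weight_le_max_tree sU); rewrite vI; apply: linked_bigcup => // d.
by case/hT.
Qed.

(** A tree on at least two vertices has an edge, and the other factors of its
    weight are at most [1]. *)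
Lemma max_tree_weight_le_max_weight K D : vertices K = [set: V] ->
  (2 <= #|D|)%N -> max_tree_weight (induced K D) <= max_weight K.
Proof.
move=> vK D2.
have [->|/max_tree_attained[T]] := eqVneq (max_tree_weight (induced K D)) 0.
  exact: bigmax_ge_id.
rewrite vertices_induced // => -[sT /linkedP lT ->].
have /card_gt1P[x [y [xD yD xy]]] := D2.
have [] := lT [set x].
  by apply/splitsP; exists x, y; rewrite !inE eqxx eq_sym.
move=> e eT _; have eE : e \in edges K.
  by have := fintype.subsetP sT e eT; rewrite /= inE => /andP[].
apply: (@le_trans _ _ (weight K e)); last first.
  exact: (le_bigmax_cond 0 (weight K)).
have -> : weight K e = \prod_(a in [set e]) weight K a by rewrite big_set1.
apply: (ler_prod_superset (f := weight K)); last by rewrite sub1set.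
by move=> a /(fintype.subsetP sT); rewrite /= inE => /andP[/weight_itv].
Qed.
End TreeWeights.

(** * Cumulants *)

Section Cumulants.
Import mathcomp.boot.finset.
Local Open Scope set_scope.
Set Implicit Arguments. Unset Strict Implicit.
Context {R : realType} {l : nat}.
Implicit Types (u w r : {set 'I_l} -> R) (A B C D d : {set 'I_l}).
Implicit Types (H pi : {set {set 'I_l}}).

Lemma prod_1D_sum (K : comNzRingType) (I : finType) (S : {set I}) (F : I -> K) :
  \prod_(x in S) (1 + F x) =
  \sum_(J : {set I} | J \subset S) \prod_(x in J) F x.
Proof.
have -> : \prod_(x in S) (1 + F x) =
    \prod_x ((if x \in S then F x else 0) + 1).
  rewrite big_mkcond; apply: eq_bigr => x _.
  by case: ifP; rewrite ?add0r // addrC.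
rewrite bigA_distr [RHS]big_mkcond; apply: eq_bigr => J _.
case: (boolP (J \subset S)) => [sJS|/fintype.subsetPn[x xJ xS]].
  rewrite [RHS]big_mkcond; apply: eq_bigr => x _.
  by case: ifP => // /(fintype.subsetP sJS) ->.
by rewrite (bigD1 x) //= xJ (negPf xS) mul0r.
Qed.

(** Adding the block [C] is a bijection from the partitions of [D :\: C] onto the
    partitions of [D] having [C] as a block, with inverse the removal of [C];
    the statement has the form that [reindex_onto] asks for. *)
Lemma partition_setU1 pi C D : C != set0 -> C \subset D ->
  [&& partition (C |: pi) D, C \in C |: pi & (C |: pi) :\ C == pi] =
  partition pi (D :\: C).
Proof.
move=> C0 sCD; apply/and3P/idP => [[pD Cpi /eqP <-]|p].
  exact: partitionD1.
have nC : C \notin pi.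
  apply: contra C0 => /(partitionS p); rewrite subsetD => /andP[_].
  by rewrite -setI_eq0 setIid.
split; rewrite ?setU11 // ?setU1K //.
rewrite -[X in partition _ X](setID D C) (setIidPr sCD); apply: partitionU1 => //.
by rewrite -setI_eq0 setIDA setDIl setDv set0I.
Qed.

Lemma card_blocks_avoiding pi D i : partition pi D -> i \in D ->
  #|[set C in pi | i \notin C]| = (#|pi| - 1)%N.
Proof.
move=> p iD; have icov : i \in cover pi by rewrite (cover_partition p).
have -> : [set C in pi | i \notin C] = pi :\ pblock pi i.
  apply/setP => C; rewrite !inE andbC; case: (boolP (C \in pi)) => Cpi; last by rewrite !andbF.
  rewrite !andbT; congr (~~ _); apply/idP/eqP => [iC|->].
    by rewrite (def_pblock (partition_trivIset p) Cpi iC).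
  by rewrite mem_pblock.
by rewrite (cardsD1 (pblock pi i) pi) pblock_mem // addnC addnK.
Qed.

(** The recursion of moments and cumulants, according to the complement [C] of
    the cumulant's index set, which contains [i].  A partition of [D] with [k]
    blocks occurs once on the right from [C = set0], and [k - 1] times with
    [C] one of its blocks avoiding [i]; the signed factorials cancel unless
    [k = 1]. *)
Lemma moment_cumulant u D i : u set0 != 0 -> i \in D ->
  u D / u set0 =
  \sum_(C : {set 'I_l} | C \subset D :\ i) u C / u set0 * cumulant u (D :\: C).
Proof.
move=> u0 iD; pose w B := u B / u set0.
pose mu k : R := (-1) ^+ (k - 1) * ((k - 1)`!)%:R.
have kE E : cumulant u E =
  \sum_(pi : {set {set 'I_l}} | partition pi E) mu #|pi| * \prod_(B in pi) w B by [].
rewrite (bigD1 set0) ?sub0set //= divff // mul1r setD0 kE.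
have -> : \sum_(C : {set 'I_l} | (C \subset D :\ i) && (C != set0))
    u C / u set0 * cumulant u (D :\: C) =
  \sum_(pi : {set {set 'I_l}} | partition pi D)
    ((#|pi| - 1)%:R * mu (#|pi| - 1)%N) * \prod_(B in pi) w B.
  transitivity (\sum_(C : {set 'I_l} | (C \subset D :\ i) && (C != set0))
    \sum_(pi : {set {set 'I_l}} | partition pi D && (C \in pi))
      mu (#|pi| - 1)%N * \prod_(B in pi) w B).
    apply: eq_bigr => C /andP[]; rewrite subsetD1 => /andP[sCD iC] C0.
    rewrite (reindex_onto (fun pi => C |: pi) (fun pi => pi :\ C)) /=; last first.
      by move=> pi /andP[_ Cpi]; rewrite setD1K.
    rewrite kE mulr_sumr; under [RHS]eq_bigl do rewrite -andbA partition_setU1 //.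
    apply: eq_bigr => pi p.
    have nC : C \notin pi.
      apply: contra C0 => /(partitionS p); rewrite subsetD => /andP[_].
      by rewrite -setI_eq0 setIid.
    by rewrite cardsU1 nC addnC addnK big_setU1 //= mulrCA.
  rewrite (exchange_big_dep (fun pi => partition pi D)) /=; last by move=> ? ? _ /andP[].
  apply: eq_bigr => pi p.
  rewrite sumr_const -(card_blocks_avoiding p iD) -mulrA mulr_natl; congr (_ *+ _).
  apply: eq_card => C; rewrite !inE unfold_in /= p /=.
  case: (boolP (C \in pi)) => Cpi; last by rewrite andbF.
  by rewrite andbT subsetD1 (partitionS p Cpi) (partition_neq0 p Cpi) andbT.
rewrite -big_split /= (bigD1 [set D]) /=; last first.
  rewrite /partition /cover big_set1 eqxx in_set1 eq_sym.
  have D0 : D != set0 by apply/set0Pn; exists i.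
  rewrite D0 andbT /=; apply/trivIsetP => ? ? /set1P-> /set1P->.
  by rewrite eqxx.
rewrite cards1 big_set1 subnn !mul0r addr0 /mu subnn expr0 !mul1r.
rewrite big1 ?addr0 // => pi /andP[p npi]; rewrite -mulrDl.
have icov : i \in cover pi by rewrite (cover_partition p).
have : (1 < #|pi|)%N.
  rewrite ltnNge; apply: contra npi; rewrite leq_eqVlt ltnS leqn0 cards_eq0.
  case/orP=> [/cards1P[B piB]|/eqP pi0]; last first.
    by move: icov; rewrite pi0 /cover big_set0 inE.
  by move: (cover_partition p); rewrite piB /cover big_set1 => ->.
case: #|pi| => [|[|k]] // _; rewrite !subn1 /= factS natrM exprS.
by rewrite mulN1r mulNr mulrCA addNr mul0r.
Qed.

(** The cumulants of independent families vanish.  In the recursion for [D], the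
    terms whose [D :\: C] meets both sides vanish by induction; the others, where
    [C] contains [D :\: A], add up to [w (D :\: A)] times the recursion for
    [D :&: A], that is, to [w D]. *)
Lemma cumulant_factorized w D A : w set0 = 1 -> splits A D ->
  (forall C, C \subset D -> w C = w (C :&: A) * w (C :\: A)) ->
  cumulant w D = 0.
Proof.
move=> w0; have [n] := ubnP #|D|; elim: n D => // n IH D ltDn sAD wD.
have wn0 : w set0 != 0 by rewrite w0 oner_neq0.
have /splitsP[i [j [iD jD iA jA]]] := sAD.
have iDA : i \in D :&: A by rewrite inE iD.
have := moment_cumulant wn0 iD; rewrite w0 divr1.
rewrite (bigD1 set0) ?sub0set //= setD0 w0 divr1 mul1r.
rewrite (bigID (fun C => D :\: A \subset C)) /= [X in _ + (_ + X)]big1 ?addr0; last first.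
  move=> C /andP[/andP[]]; rewrite subsetD1 => /andP[sCD iC] C0.
  move=> /fintype.subsetPn[y /setDP[yD yA] yC].
  have iE : i \in D :\: C by rewrite inE iD iC.
  rewrite IH ?mulr0 //.
  - rewrite -ltnS; apply: leq_trans ltDn; rewrite ltnS; apply: proper_card.
    have /set0Pn[z zC] := C0; rewrite properE subsetDl /=.
    by apply/fintype.subsetPn; exists z; rewrite ?inE ?zC // (fintype.subsetP sCD).
  - by apply/splitsP; exists i, y; rewrite iE !inE yD yC.
  - by move=> E sE; apply: wD; apply: fintype.subset_trans sE (subsetDl _ _).
rewrite (reindex_onto (fun C => C :|: (D :\: A)) (fun C => C :&: A)) /=; last first.
  move=> C /andP[/andP[]]; rewrite subsetD1 => /andP[sCD _] _ sDAC.
  apply/setP => x; rewrite !inE; have := fintype.subsetP sDAC x.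
  have := fintype.subsetP sCD x; rewrite !inE.
  by case: (x \in A); case: (x \in C); case: (x \in D) => //= h1 h2;
     rewrite ?h1 ?h2.
have jDA : j \in D :\: A by rewrite inE jA.
rewrite (eq_bigl (fun C => C \subset (D :&: A) :\ i)); last first.
  move=> C; apply/idP/idP => [/andP[/andP[/andP[sC _] _] /eqP CA]|sC].
    apply/fintype.subsetP => x xC.
    have xA : x \in A by move: xC; rewrite -{1}CA => /setIP[].
    have := fintype.subsetP sC x; rewrite !inE xC xA => /(_ isT)/andP[-> ->].
    by [].
  have sCA : C \subset A.
    by apply: fintype.subset_trans sC (fintype.subset_trans (subsetDl _ _) (subsetIr _ _)).
  move: sC; rewrite !subsetD1 => /andP[sC iC].
  have -> : (C :|: (D :\: A)) :&: A == C.
    by rewrite setIUl (setIidPl sCA) setDE -setIA [~: A :&: A]setIC setICr setI0 setU0.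
  rewrite andbT subUset subsetDl (fintype.subset_trans sC (subsetIl _ _)) /=.
  rewrite !inE negb_or iC iA /= subsetUr andbT.
  by apply/set0Pn; exists j; rewrite inE jDA orbT.
have wA0 : w (D :&: A) = \sum_(C : {set 'I_l} | C \subset (D :&: A) :\ i)
    w C * cumulant w ((D :&: A) :\: C).
  have := moment_cumulant wn0 iDA; rewrite w0 divr1 => ->.
  by apply: eq_bigr => C _; rewrite divr1.
rewrite (eq_bigr (fun C => w (D :\: A) * (w C * cumulant w ((D :&: A) :\: C)))); last first.
  move=> C; rewrite subsetD1 => /andP[sC _].
  have [sCD sCA] : C \subset D /\ C \subset A by apply/andP; rewrite -subsetI.
  rewrite divr1 (wD (C :|: (D :\: A))) ?subUset ?sCD ?subsetDl // mulrA [w (D :\: A) * _]mulrC.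
  congr (w _ * w _ * cumulant w _); apply/setP => x; rewrite !inE;
    have := fintype.subsetP sCD x; have := fintype.subsetP sCA x;
    by case: (x \in A); case: (x \in C); case: (x \in D) => //= h1 h2;
      rewrite ?h1 ?h2 // -(h1 isT) -?(h2 isT).
rewrite -mulr_sumr -wA0 (wD D) // [w (D :\: A) * _]mulrC.
by rewrite -[LHS]add0r => /addIr.
Qed.

Definition hyperedges C : {set {set 'I_l}} :=
  [set d : {set 'I_l} | (d \subset C) && (2 <= #|d|)%N].

(** The product over the blocks of a partition is the indicator that every
    member of [H] lies in a block ([prod_indep]).  The second alternative, rather
    than containment alone, is what makes this a product over blocks. *)
Definition indep H C : R :=
  \prod_(d in H) ((d \subset C) || [disjoint d & C])%:R.

Definition factored r C : R := \prod_(d in hyperedges C) (1 + r d).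

Lemma hyperedges0 : hyperedges set0 = set0.
Proof.
apply/setP => d; rewrite !inE subset0; apply/negP => /andP[/eqP->].
by rewrite cards0.
Qed.

Lemma factored0 r : factored r set0 = 1.
Proof. by rewrite /factored hyperedges0 big_set0. Qed.

Lemma indep0 H : indep H set0 = 1.
Proof.
by apply: big1 => d _; rewrite -setI_eq0 setI0 eqxx orbT.
Qed.

Lemma prod_indep pi D d : partition pi D -> d \in hyperedges D ->
  \prod_(B in pi) ((d \subset B) || [disjoint d & B])%:R =
  [exists B in pi, d \subset B]%:R :> R.
Proof.
move=> p; rewrite inE => /andP[dD d2].
case: (boolP [exists B in pi, d \subset B]) => [/existsP[B /andP[Bpi dB]]|].
  apply: big1 => B' B'pi; have [<-|nBB'] := eqVneq B B'; first by rewrite dB.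
  have /trivIsetP/(_ _ _ Bpi B'pi nBB') BB' := partition_trivIset p.
  by rewrite (disjointWl dB BB') orbT.
rewrite negb_exists => /forallP nB.
have /card_gt0P[x xd] : (0 < #|d|)%N by apply: leq_trans d2.
have xcov : x \in cover pi.
  by rewrite (cover_partition p) (fintype.subsetP dD).
rewrite (bigD1 (pblock pi x)) /= ?pblock_mem //.
have := nB (pblock pi x); rewrite pblock_mem //= => /negPf->.
suff /negPf-> : ~~ [disjoint d & pblock pi x] by rewrite mul0r.
apply/negP => /pred0P/(_ x); by rewrite /= xd mem_pblock xcov.
Qed.

(** A hyperedge contributes its factor once if it lies in a block, and not at
    all otherwise. *)
Lemma prod_factored r pi D : partition pi D ->
  \prod_(B in pi) factored r B = \prod_(d in hyperedges D)
    (1 + r d * \prod_(B in pi) ((d \subset B) || [disjoint d & B])%:R).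
Proof.
move=> p; rewrite /factored (exchange_big_dep (mem (hyperedges D))) /=; last first.
  move=> B d Bpi; rewrite !inE => /andP[dB ->].
  by rewrite (fintype.subset_trans dB (partitionS p Bpi)).
apply: eq_bigr => d dE; rewrite (prod_indep p dE).
have d2 : (2 <= #|d|)%N by move: dE; rewrite inE => /andP[].
case: (boolP [exists B in pi, d \subset B]) => [/existsP[B /andP[Bpi dB]]|].
  rewrite (big_pred1 B) ?mulr1 // => B'; rewrite inE d2 andbT.
  apply/andP/eqP => [[B'pi dB']|->//]; apply/esym/eqP; apply/negPn/negP => nBB'.
  have /trivIsetP/(_ _ _ Bpi B'pi nBB') := partition_trivIset p.
  have /card_gt0P[x xd] : (0 < #|d|)%N by apply: leq_trans d2.
  move/pred0P/(_ x).
  by rewrite /= (fintype.subsetP dB) // (fintype.subsetP dB').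
rewrite negb_exists => /forallP nB; rewrite mulr0 addr0 big_pred0 // => B.
by rewrite inE d2 andbT; apply/negbTE/nB.
Qed.

Lemma cumulant_factored r D : cumulant (factored r) D =
  \sum_(H : {set {set 'I_l}} | H \subset hyperedges D)
    (\prod_(d in H) r d) * cumulant (indep H) D.
Proof.
rewrite /cumulant factored0; under [RHS]eq_bigr do rewrite indep0 mulr_sumr.
rewrite [RHS]exchange_big /=; apply: eq_bigr => pi p.
under eq_bigr do rewrite divr1.
rewrite (prod_factored _ p) prod_1D_sum mulr_sumr; apply: eq_bigr => H _.
rewrite big_split /= mulrCA; congr (_ * (_ * _)).
by rewrite exchange_big; apply: eq_bigr => B _; rewrite divr1.
Qed.

(** A cut [A] that no member of [H] crosses makes [indep H] multiplicative: a
    member of [H] inside [A] only constrains [C :&: A], one outside [A] only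
    constrains [C :\: A]. *)
Lemma cumulant_indep_unlinked H D : ~~ linked H D ->
  cumulant (indep H) D = 0.
Proof.
rewrite negb_forall => /existsP[A]; rewrite negb_imply => /andP[sAD].
rewrite negb_exists => /forallP nA.
apply: (cumulant_factorized (indep0 H) sAD) => C _.
rewrite -big_split; apply: eq_bigr => d dH /=; rewrite -natrM mulnb.
congr (_%:R); congr nat_of_bool.
have := nA d; rewrite dH /= /splits negb_and !negbK setD_eq0.
rewrite -!setI_eq0 => /orP[|] dA.
  have dC : d :&: (C :\: A) = d :&: C.
    by rewrite setIDA -setIDAC (setDidPl _) // -setI_eq0.
  have -> : (d :&: (C :&: A)) == set0 by rewrite setICA (eqP dA) setI0.
  by rewrite orbT andTb dC subsetD -setI_eq0 dA andbT.
rewrite setIA setIAC (setIidPl dA) subsetI dA andbT.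
suff -> : d :&: (C :\: A) == set0 by rewrite orbT andbT.
by rewrite setIDA setIC -setIDA (eqP (_ : d :\: A == set0)) ?setI0 // setD_eq0.
Qed.

(** Only connected hypergraphs contribute, and for these the product of the
    bounds is at most the bound for [D]. *)
Lemma ler_cumulant_factored r (M : {set 'I_l} -> R) (c : R) D : 0 <= c ->
  (forall d, d \in hyperedges D -> `|r d| <= c * M d) ->
  (forall H, H \subset hyperedges D -> linked H D ->
     \prod_(d in H) M d <= M D) ->
  `|cumulant (factored r) D| <=
  (\sum_(H : {set {set 'I_l}} | H \subset hyperedges D)
    c ^+ #|H| * `|cumulant (indep H) D|) * M D.
Proof.
move=> c0 rM MD; rewrite cumulant_factored mulr_suml.
apply: le_trans (ler_norm_sum _ _ _) _; apply: ler_sum => H sH.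
rewrite normrM [leRHS]mulrAC.
case: (boolP (linked H D)) => [lH|/cumulant_indep_unlinked->]; last first.
  by rewrite normr0 !mulr0.
apply: ler_wpM2r => //; rewrite normr_prod.
apply: (@le_trans _ _ (\prod_(d in H) (c * M d))).
  by apply: ler_prod => d /(fintype.subsetP sH) dE; rewrite normr_ge0 rM.
by rewrite big_split /= prodr_const ler_wpM2l ?exprn_ge0 // MD.
Qed.

Lemma sum_signs (S : {set 'I_l}) :
  \sum_(J : {set 'I_l} | J \subset S) (-1) ^+ #|J| = (S == set0)%:R :> int.
Proof.
under eq_bigr do rewrite -prodr_const.
rewrite -prod_1D_sum subrr; have [->|/set0Pn[x xS]] := eqVneq S set0.
  by rewrite big_set0.
by rewrite (big_setD1 x) //= mul0r.
Qed.

(** Multiplicative Moebius inversion: the exponent of [u e] is the alternating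
    sum over the sets between [e] and [C], which is zero unless [e = C]. *)
Lemma prod_alt_prod u C : (forall D, u D != 0) ->
  \prod_(d : {set 'I_l} | d \subset C) alt_prod u d = u C.
Proof.
move=> un0; rewrite /alt_prod.
rewrite (exchange_big_dep (fun e : {set 'I_l} => e \subset C)) /=; last first.
  by move=> d e dC ed; apply: fintype.subset_trans ed dC.
have pow (e : {set 'I_l}) : e \subset C ->
    \prod_(d : {set 'I_l} | (d \subset C) && (e \subset d))
      u e ^ ((-1) ^+ (#|d| - #|e|) : int) = u e ^ ((C :\: e == set0)%:R : int).
  move=> eC; have expD : {morph (fun z : int => u e ^ z) : x y / x + y >-> x * y}.
    by move=> x y; rewrite expfzDr.
  rewrite -(big_morph _ expD (expr0z _)); congr (_ ^ _).
  rewrite -sum_signs (reindex_onto (fun J => e :|: J) (fun d => d :\: e)) /=; last first.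
    by move=> d /andP[_ ed]; rewrite -{1}(setIidPr ed) setID.
  apply: eq_big => [J|J /andP[_ /eqP JE]]; last first.
    by rewrite -{2}JE cardsD (setIidPr (subsetUl e J)).
  rewrite subUset eC subsetUl andbT /= setDUl setDv set0U subsetD -setI_eq0.
  by congr (_ && _); rewrite (sameP eqP setDidPl) -setI_eq0.
rewrite (bigD1 C) //= pow // setDv eqxx expr1z big1 ?mulr1 // => e /andP[eC nC].
rewrite pow // setD_eq0; suff /negPf-> : ~~ (C \subset e) by rewrite expr0z.
by apply: contra nC => Ce; rewrite eqEsubset eC.
Qed.

(** Moebius inversion with the empty set and the singletons set apart, for which
    [alt_prod] is [u set0] and [u [set i] / u set0]. *)
Lemma alt_prod_factorization u C : (forall D, u D != 0) ->
  u C / u set0 = (\prod_(i in C) (u [set i] / u set0)) *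
    factored (fun d => alt_prod u d - 1) C.
Proof.
move=> un0; rewrite -{1}(prod_alt_prod C un0).
rewrite (bigD1 set0) ?sub0set //=.
have -> : alt_prod u set0 = u set0.
  rewrite /alt_prod (big_pred1 set0) => [|d]; last by rewrite subset0.
  by rewrite subnn expr0 expr1z.
rewrite mulrC mulKf // (bigID (fun d => 2 <= #|d|)%N) /= mulrC; congr (_ * _).
  rewrite (eq_bigl (mem [set [set i] | i in C])) => [|d]; last first.
    apply/idP/imsetP => [/andP[/andP[dC d0]]|[i iC ->]].
      rewrite -ltnNge ltnS leq_eqVlt ltnS leqn0 cards_eq0 (negPf d0) orbF.
      by case/cards1P => i di; exists i => //; move: dC; rewrite di sub1set.
    by rewrite sub1set iC cards1 andbT; apply/set0Pn; exists i; rewrite inE.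
  rewrite big_imset /=; last by move=> i j _ _ /set1_inj.
  apply: eq_bigr => i _; rewrite /alt_prod (bigD1 [set i]) //= subnn expr0 expr1z.
  congr (_ * _); rewrite (big_pred1 set0) => [|d].
    by rewrite cards1 cards0 expr1 exprN1.
  rewrite subset1; have [->|nd] := eqVneq d [set i]; last by rewrite andbT.
  by rewrite andbF; apply/esym/negbTE/set0Pn; exists i; rewrite inE.
apply: eq_big => [d|d _]; last by rewrite addrC subrK.
rewrite inE -andbA; congr (_ && _).
rewrite andb_idl // => d2; rewrite -card_gt0; exact: leq_trans d2.
Qed.

Lemma cumulant_scale u (a : 'I_l -> R) w D : w set0 = 1 ->
  (forall C, u C / u set0 = (\prod_(i in C) a i) * w C) ->
  cumulant u D = (\prod_(i in D) a i) * cumulant w D.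
Proof.
move=> w0 uE; rewrite /cumulant mulr_sumr; apply: eq_bigr => pi p.
rewrite mulrCA; congr (_ * _); rewrite (set_partition_big _ p) -big_split /=.
by apply: eq_bigr => B _; rewrite uE w0 divr1.
Qed.

Lemma eq_cumulant u w D : (forall C, C \subset D -> u C = w C) ->
  cumulant u D = cumulant w D.
Proof.
move=> uw; apply: eq_bigr => pi p; congr (_ * _); apply: eq_bigr => B Bpi.
by rewrite !uw ?sub0set // (partitionS p).
Qed.

(** Among the terms of the cumulant, only the one-block partition sees [r D], and
    its term is [factored r D = (1 + r D) * factored r' D]. *)
Lemma factored_cumulant_sub r D : (2 <= #|D|)%N ->
  let r' d := if d == D then 0 else r d in
  cumulant (factored r) D = cumulant (factored r') D + r D * factored r' D.
Proof.
move=> D2 r'.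
have DE : D \in hyperedges D by rewrite inE subxx.
have wD : factored r D = (1 + r D) * factored r' D.
  rewrite /factored (bigD1 D) //= [in RHS](bigD1 D) //=.
  have -> : r' D = 0 by rewrite /r' eqxx.
  rewrite addr0 mul1r.
  by congr (_ * _); apply: eq_bigr => d /andP[_ /negPf dD]; rewrite /r' dD.
have wC C : C \proper D -> factored r C = factored r' C.
  move=> CD; apply: eq_bigr => d; rewrite inE => /andP[dC _]; rewrite /r'.
  by case: eqVneq => // dD; move: CD; rewrite -dD properE dC andbF.
have /card_gt0P[i iD] : (0 < #|D|)%N by apply: leq_trans D2.
have kE q : cumulant (factored q) D = factored q D -
    \sum_(C : {set 'I_l} | (C \subset D :\ i) && (C != set0))
      factored q C * cumulant (factored q) (D :\: C).
  have q0 : factored q set0 != 0 by rewrite factored0 oner_neq0.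
  have := moment_cumulant q0 iD; rewrite factored0 divr1 => ->.
  rewrite (bigD1 set0) ?sub0set //= factored0 setD0 divr1 mul1r.
  by under [X in _ + X - _]eq_bigr do rewrite divr1; rewrite addrK.
rewrite !kE wD mulrDl mul1r -addrA [r D * _ - _]addrC addrA; congr (_ - _ + _).
apply: eq_bigr => C /andP[]; rewrite subsetD1 => /andP[sCD iC] C0.
rewrite wC; last by rewrite properE sCD; apply/fintype.subsetPn; exists i.
congr (_ * _); apply: eq_cumulant => B sB; apply: wC.
rewrite properE (fintype.subset_trans sB (subsetDl _ _)) /=.
have /set0Pn[z zC] := C0; apply/fintype.subsetPn; exists z.
  by rewrite (fintype.subsetP sCD).
by apply/negP => /(fintype.subsetP sB); rewrite inE zC.
Qed.
End Cumulants.

(** * Asymptotics *)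

Section Asymptotics.
Import mathcomp.boot.finset.
Local Open Scope set_scope.
Set Implicit Arguments. Unset Strict Implicit.
Context {R : realType}.

(** Finitely many asymptotic bounds hold with a common constant. *)
Lemma near_bound_uniform (I : finType) (P : pred I) (f M : I -> nat -> R) :
  (forall i n, 0 <= M i n) ->
  (forall i, P i ->
    exists2 c : R, 0 < c & \forall n \near \oo, `|f i n| <= c * M i n) ->
  exists2 c : R, 0 < c &
    \forall n \near \oo, forall i, P i -> `|f i n| <= c * M i n.
Proof.
move=> M0 h.
have /boolp.choice[c hc] : forall i, exists c : R, 0 < c /\ (P i ->
    exists N, forall n, (N <= n)%N -> `|f i n| <= c * M i n).
  move=> i; case: (boolP (P i)) => [/h[c c0 [N _ hN]]|_]; last by exists 1.
  by exists c; split=> // _; exists N => n Nn; apply: hN.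
have /boolp.choice[N hN] : forall i, exists N, P i ->
    forall n, (N <= n)%N -> `|f i n| <= c i * M i n.
  move=> i; have [_] := hc i; case: (P i) => [/(_ isT)[N hN]|_].
    by exists N.
  by exists 0%N.
have c0 i : 0 <= c i by have [/ltW] := hc i.
exists (1 + \sum_i c i); first by rewrite ltr_pwDl // sumr_ge0.
exists (\max_i N i)%N => // n /= Nn i Pi.
apply: le_trans (hN i Pi n (leq_trans (leq_bigmax i) Nn)) _.
apply: ler_wpM2r => //; rewrite (bigD1 i) //= addrCA lerDl addr_ge0 //.
exact: sumr_ge0.
Qed.

Context {l : nat} (L : nat -> wgraph R 'I_l) (u : nat -> {set 'I_l} -> R).
Implicit Types D : {set 'I_l}.

Let M D n := max_tree_weight (induced (L n) D).
Let r n D := alt_prod (u n) D - 1.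

Let M_ge0 D n : 0 <= M D n. Proof. exact: max_tree_weight_ge0. Qed.

Lemma quasi_factorizationP : quasi_factorization_property L u <->
  forall D, (2 <= #|D|)%N -> exists2 c : R, 0 < c &
    \forall n \near \oo, `|alt_prod (u n) D - 1| <= c * M D n.
Proof.
split=> h D D2.
  have [c c0 hc] := (bigO_exP _ _ _).2 ((eqaddOP _ _ _ _).1 (h D D2)).
  exists c => //; apply: filterS hc => n /=.
  by rewrite [X in _ * X]ger0_norm ?max_tree_weight_ge0.
have [c c0 hc] := h D D2.
apply/eqaddOP/bigO_exP; exists c => //; apply: filterS hc => n /=.
by rewrite [X in _ -> _ <= _ * X]ger0_norm ?max_tree_weight_ge0.
Qed.

Lemma cumulant_alt_prod n D : (forall C, u n C != 0) ->
  cumulant (u n) D = (\prod_(i in D) (u n [set i] / u n set0)) *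
    cumulant (factored (r n)) D.
Proof.
move=> un0; apply: cumulant_scale; first exact: factored0.
by move=> C; apply: alt_prod_factorization.
Qed.

(** The product of the singletons cancels, whatever its sign: the witness for
    the definition may itself be negative. *)
Lemma small_cumulantP : (\forall n \near \oo, forall C, u n C != 0) ->
  small_cumulant_property L u <->
  forall D, (2 <= #|D|)%N -> exists2 c : R, 0 < c &
    \forall n \near \oo, `|cumulant (factored (r n)) D| <= c * M D n.
Proof.
move=> un0.
have prod_neq0 n D : (forall C, u n C != 0) ->
    \prod_(i in D) (u n [set i] / u n set0) != 0.
  by move=> n0; apply/prodf_neq0 => i _; rewrite mulf_neq0 ?invr_neq0.
split=> h D D2; last first.
  have [c c0 hc] := h D D2.
  pose a n := \prod_(i in D) (u n [set i] / u n set0).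
  exists (fun n => `|cumulant (u n) D| / a n); last first.
    apply: filterS un0 => n /prod_neq0 an0; by rewrite mulrCA divff ?mulr1.
  apply/eqO_exP; exists c => //.
  apply: filterS2 un0 hc => n n0 /=.
  rewrite [X in _ -> _ <= _ * X]ger0_norm ?max_tree_weight_ge0 // normrM normr_id normfV.
  by rewrite cumulant_alt_prod // normrM mulrAC divff ?mul1r ?normr_eq0 ?prod_neq0.
have [g /eqO_exP[c c0 hc] hg] := h D D2.
exists c => //; apply: filterS3 un0 hc hg => n n0 /=.
rewrite [X in _ <= _ * X -> _]ger0_norm ?max_tree_weight_ge0 // cumulant_alt_prod // normrM => gc.
move/(congr1 (fun x => `|x|)); rewrite !normrM !normr_id.
by move/mulfI; rewrite normr_eq0 prod_neq0 // => /(_ isT) ->.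
Qed.

Hypothesis vL : \forall n \near \oo, vertices (L n) = [set: 'I_l].

Lemma near_cumulant_factored (q : nat -> {set 'I_l} -> R) (c : R) D : 0 < c ->
  (\forall n \near \oo, forall d, d \in hyperedges D -> `|q n d| <= c * M d n) ->
  exists2 k : R, 0 < k &
    \forall n \near \oo, `|cumulant (factored (q n)) D| <= k * M D n.
Proof.
move=> c0 hq.
set s := \sum_(H : {set {set 'I_l}} | H \subset hyperedges D)
  c ^+ #|H| * `|cumulant (indep H : _ -> R) D|.
have s0 : 0 <= s by apply: sumr_ge0 => H _; rewrite mulr_ge0 ?exprn_ge0 // ltW.
exists (1 + s); first by rewrite ltr_pwDl.
apply: filterS2 vL hq => n vn qn; rewrite mulrDl mul1r ler_wpDl //.
apply: (ler_cumulant_factored (M := fun d => M d n) (ltW c0)) => // H sH lH.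
apply: prod_max_tree_weight_le => // d /(fintype.subsetP sH).
by rewrite inE => /andP[].
Qed.

Lemma quasi_factorization_small_cumulant :
  (\forall n \near \oo, forall C, u n C != 0) ->
  quasi_factorization_property L u -> small_cumulant_property L u.
Proof.
move=> un0 /quasi_factorizationP h; apply/small_cumulantP => // D D2.
have [|c c0 hc] := @near_bound_uniform _ (mem (hyperedges D))
  (fun d n => r n d) M M_ge0.
  by move=> d; rewrite /= inE => /andP[_ d2]; apply: h.
exact: near_cumulant_factored c0 hc.
Qed.

(** Induction on [#|D|], comparing [r] with the list [r'] obtained by putting [0]
    at [D]. *)
Lemma small_cumulant_quasi_factorization :
  (\forall n \near \oo, forall C, u n C != 0) ->
  (fun n => max_weight (L n)) @ \oo --> (0 : R) ->
  small_cumulant_property L u -> quasi_factorization_property L u.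
Proof.
move=> un0 wL /(small_cumulantP un0) h; apply/quasi_factorizationP => D.
have [m] := ubnP #|D|; elim: m D => // m IH D ltDm D2.
have [|c c0 hc] := @near_bound_uniform _
  (fun d => (d \in hyperedges D) && (d != D)) (fun d n => r n d) M M_ge0.
  move=> d /andP[]; rewrite inE => /andP[dD d2] nd; apply: IH => //.
  rewrite -ltnS; apply: leq_trans ltDm; rewrite ltnS; apply: proper_card.
  by rewrite properEneq nd.
pose r' n d := if d == D then 0 else r n d.
have hr' : \forall n \near \oo,
    forall d, d \in hyperedges D -> `|r' n d| <= c * M d n.
  apply: filterS hc => n hn d dE; rewrite /r'; case: eqVneq => dD.
    by rewrite normr0 mulr_ge0 ?M_ge0 // ltW.
  by apply: hn; rewrite dE.
have [k k0 hk] := near_cumulant_factored c0 hr'.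
have [b b0 hb] := h D D2.
(* Below this threshold |r' d| <= 1/2 for every hyperedge d. *)
have hw : \forall n \near \oo, max_weight (L n) <= (2 * c)^-1.
  have e0 : 0 < (2 * c)^-1 by rewrite invr_gt0 mulr_gt0.
  move/cvgrPdist_le: wL => /(_ _ e0); apply: filterS => n.
  by rewrite sub0r normrN; apply: le_trans; apply: ler_norm.
exists ((b + k) * 2 ^+ #|hyperedges D|).
  by rewrite mulr_gt0 ?addr_gt0 ?exprn_gt0.
near=> n.
have r'n : forall d, d \in hyperedges D -> `|r' n d| <= c * M d n by near: n.
have kn : `|cumulant (factored (r' n)) D| <= k * M D n by near: n.
have bn : `|cumulant (factored (r n)) D| <= b * M D n by near: n.
have wn : max_weight (L n) <= (2 * c)^-1 by near: n.
have vn : vertices (L n) = [set: 'I_l] by near: n.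
have lower : 2 ^- #|hyperedges D| <= `|factored (r' n) D|.
  rewrite normr_prod -exprVn -prodr_const; apply: ler_prod => d dE.
  rewrite invr_ge0 ler0n /=.
  have : `|r' n d| <= 2^-1.
    apply: le_trans (r'n d dE) _.
    have d2 : (2 <= #|d|)%N by move: dE; rewrite inE => /andP[].
    have := le_trans (max_tree_weight_le_max_weight vn d2) wn.
    by rewrite -ler_pdivlMl // -invfM [c * 2]mulrC.
  by rewrite ler_norml => /andP[r1 _]; apply: le_trans (ler_norm _); lra.
have := factored_cumulant_sub (r n) D2; rewrite /= -/(r' n) => kE.
have : `|r n D| * `|factored (r' n) D| <= (b + k) * M D n.
  rewrite -normrM [leRHS]mulrDl.
  have -> : r n D * factored (r' n) D =
    cumulant (factored (r n)) D - cumulant (factored (r' n)) D.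
    by rewrite kE [X in X - _]addrC addrK.
  by apply: le_trans (ler_normB _ _) _; apply: lerD.
move=> le1; rewrite mulrAC -ler_pdivrMr ?exprn_gt0 //.
by apply: le_trans le1; apply: ler_wpM2l.
Unshelve. all: by end_near. Qed.

End Asymptotics.

Theorem proposition5p8 (R : realType) (l : nat) (n0 : nat)
    (L : nat -> wgraph R 'I_l) (u : nat -> {set 'I_l} -> R)
    (l_ge1 : (1 <= l)%N)
    (vertices_L : forall n : nat, (n0 <= n)%N -> vertices (L n) = [set: 'I_l]%SET)
    (u_neq0 : forall (n : nat) (D : {set 'I_l}), (n0 <= n)%N -> u n D != 0) :
  (quasi_factorization_property L u -> small_cumulant_property L u) /\
  ((fun n => max_weight (L n)) @ \oo --> (0 : R) ->
   (small_cumulant_property L u <-> quasi_factorization_property L u)).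
Proof.
have vL : \forall n \near \oo, vertices (L n) = [set: 'I_l]%SET.
  by exists n0 => // n; apply: vertices_L.
have un0 : \forall n \near \oo, forall C, u n C != 0.
  by exists n0 => // n /= n0n C; apply: u_neq0.
have qs := quasi_factorization_small_cumulant vL un0.
split=> // wL; split=> //.
exact: small_cumulant_quasi_factorization vL un0 wL.
Qed.
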